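(* Let $f_1,f_2$ be power spectral density functions on $[-\pi,\pi)$ with $f_1^{-1},f_2^{-1}\in L_1[-\pi,\pi)$. Suppose the smoothing filter that is optimal for $f_2$ is used on a process with power spectral density $f_1$, so that the variance of the smoothing error is $\frac{1}{2\pi}\int_{-\pi}^{\pi}|h_{f_2}f_2(\theta)^{-1}|^2f_1(\theta)\,d\theta$. Then the ratio $\rho_{\rm smooth}(f_1,f_2)$ of this variance to the optimal (least) smoothing error variance $h_{f_1}$ for $f_1$ satisfies $$\rho_{\rm smooth}(f_1,f_2)=\left(\frac{1}{2\pi}\int_{-\pi}^{\pi}\frac{f_1(\theta)}{f_2(\theta)^2}\,d\theta\right)\frac{\frac{1}{2\pi}\int_{-\pi}^{\pi}f_1(\theta)^{-1}d\theta}{\left(\frac{1}{2\pi}\int_{-\pi}^{\pi}f_2(\theta)^{-1}d\theta\right)^2}=\left(\frac{\sqrt{\frac{1}{2\pi}\int_{-\pi}^{\pi}\left(\frac{f_1(\theta)}{f_2(\theta)}\right)^2d\phi_1(\theta)}}{\frac{1}{2\pi}\int_{-\pi}^{\pi}\frac{f_1(\theta)}{f_2(\theta)}\,d\phi_1(\theta)}\right)^2$$ (as identities in $[0,\infty]$), where $$d\phi_1(\theta):=\frac{f_1(\theta)^{-1}d\theta}{\frac{1}{2\pi}\int_{-\pi}^{\pi}f_1(\vartheta)^{-1}d\vartheta}.$$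
   Context: A power spectral density function is a nonnegative integrable function on $[-\pi,\pi)$. If $f^{-1}\in L_1[-\pi,\pi)$, set $h_f:=\left(\frac{1}{2\pi}\int_{-\pi}^{\pi}f(\theta)^{-1}d\theta\right)^{-1}$, the harmonic mean of $f$. This is the least variance of the error $u_0-\sum_{k\neq0}\beta_ku_{-k}$ in estimating $u_0$ from all past and future values of a stationary process with spectral density $f$; the $f$-optimal smoothing error corresponds, under the Kolmogorov isomorphism $\sum_k a_ku_{-k}\mapsto\sum_k a_ke^{jk\theta}$, to the function $h_ff(\theta)^{-1}$, and its variance on a process with spectral density $g$ is $\frac{1}{2\pi}\int_{-\pi}^{\pi}|h_ff(\theta)^{-1}|^2g(\theta)\,d\theta$. *)

(* Defs.v *)
From HB Require Import structures.
From mathcomp Require Import all_boot all_order all_algebra.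
From mathcomp Require Import all_classical all_reals all_analysis.

Set Implicit Arguments.
Unset Strict Implicit.
Unset Printing Implicit Defensive.

Import Order.TTheory GRing.Theory Num.Theory.
Import numFieldNormedType.Exports.

Local Open Scope classical_set_scope.
Local Open Scope ring_scope.
Local Open Scope ereal_scope.

Section SpectralDensities.
Context {R : realType}.
Implicit Types f g : R -> R.

Definition circle : set R := `[(- pi)%R, pi[.

Definition spectral_density f : Prop :=
  (forall t, circle t -> (0 <= f t)%R) /\
  lebesgue_measure.-integrable circle (fun t => (f t)%:E).

(* The inverse is taken in [\bar R], where [0^-1 = +oo]: with the inverse of
   [R], for which [0^-1 = 0], a density vanishing on a set of positive measure
   could pass for one with an integrable inverse. *)
Definition integrable_inverse f : Prop :=
  lebesgue_measure.-integrable circle (fun t => (f t)%:E^-1).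

(* [nu] is a bare set function so that both [lebesgue_measure] and [phi f]
   below can be used; its type fixes the measurable structure as the one that
   carries [lebesgue_measure]. *)
Definition mean (nu : set (measurableTypeR R) -> \bar R) (u : R -> \bar R) : \bar R :=
  ((2 * pi)^-1)%:E * \int[nu]_(t in circle) u t.

Definition inverse_mean f : \bar R :=
  mean lebesgue_measure (fun t => (f t)%:E^-1).

Definition harmonic_mean f : \bar R := (inverse_mean f)^-1.

(* The image of the [f]-optimal smoothing error under the Kolmogorov
   isomorphism. *)
Definition smoothing_error f : R -> \bar R :=
  fun t => harmonic_mean f * (f t)%:E^-1.

(* Variance of the [f]-optimal smoothing error on a process of density [g]. *)
Definition smoothing_variance f g : \bar R :=
  mean lebesgue_measure (fun t => `|smoothing_error f t| ^+ 2 * (g t)%:E).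

(* [harmonic_mean f1] is the least smoothing error variance for [f1]. *)
Definition rho_smooth f1 f2 : \bar R :=
  smoothing_variance f2 f1 / harmonic_mean f1.

(* Carried by [circle], with total mass [2 * pi]. *)
Definition phi f : set (measurableTypeR R) -> \bar R :=
  fun A => \int[lebesgue_measure]_(t in A `&` circle)
             ((f t)%:E^-1 / inverse_mean f).

End SpectralDensities.

(* Main.v *)
(* Each [f^-1] is integrable and nowhere zero, so its mean is a positive real and
   the constants [h_f1] and [h_f2] come out of the integrals: this is the first
   identity.  For the second, integrating against [phi f1] is integrating with
   the weight [h_f1 * f1^-1]; as [f1 != 0] almost everywhere, the means of
   [f1 / f2] and [(f1 / f2)^2] against [phi f1] are [h_f1] times those of [f2^-1]
   and [f1 / f2^2] against the Lebesgue measure.  Only the mean of [f1 / f2^2]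
   may be infinite. *)

Require Import Defs.
From HB Require Import structures.
From mathcomp Require Import all_boot all_order all_algebra.
From mathcomp Require Import all_classical all_reals all_analysis.
From mathcomp Require Import measurable_realfun ring.

Set Implicit Arguments.
Unset Strict Implicit.
Unset Printing Implicit Defensive.

Import Order.TTheory GRing.Theory Num.Theory.
Import HBNNSimple.

Local Open Scope classical_set_scope.
Local Open Scope ring_scope.
Local Open Scope ereal_scope.

(** Integration against a measure with density [g], where [g] may take the value [+oo]. Monotone
    convergence along simple functions increasing to [f] reduces it to indicators of level sets, for
    which it is the hypothesis on [nu]. *)
Lemma ge0_integral_density d (T : measurableType d) (R : realType)
    (mu nu : {measure set T -> \bar R}) (D : set T) (f g : T -> \bar R) :
  measurable D ->
  measurable_fun D f -> (forall x, D x -> 0 <= f x) ->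
  measurable_fun D g -> (forall x, D x -> 0 <= g x) ->
  (forall A, measurable A -> A `<=` D -> nu A = \int[mu]_(x in A) g x) ->
  \int[nu]_(x in D) f x = \int[mu]_(x in D) (f x * g x).
Proof.
move=> mD mf f0 mg g0 nuE; pose h := nnsfun_approx mD mf.
have h_nd x : {homo h^~ x : m n / (m <= n)%N >-> (m <= n)%R}.
  by move=> m n mn; exact/lefP/nd_nnsfun_approx.
have h_cvg x : D x -> (h n x)%:E @[n --> \oo] --> f x.
  by move=> Dx; exact: (cvg_nnsfun_approx mD mf f0 Dx).
have hg_cvg x : D x -> (h n x)%:E * g x @[n --> \oo] --> f x * g x.
  move=> Dx; have [gfin|] := boolP (g x \is a fin_num).
    by apply: cvgeZr => //; exact: h_cvg.
  (* Where [g] is infinite, [h n x * g x] is eventually constant. *)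
  rewrite ge0_fin_numE ?g0// ltey negbK => /eqP gxE; rewrite gxE.
  have [h0|/existsNP[N /eqP hN]] := pselect (forall n, h n x = 0%R).
    have -> : f x = 0.
      rewrite -(cvg_lim _ (h_cvg x Dx))//; apply: lim_near_cst => //.
      by apply: nearW => n; rewrite h0.
    by rewrite mul0e; apply: cvg_near_cst; apply: nearW => n; rewrite h0 mul0e.
  have hN0 n : (N <= n)%N -> 0 < (h n x)%:E.
    by move=> /(h_nd x); apply: lt_le_trans; rewrite lt0r hN fun_ge0.
  rewrite gt0_muley; last first.
    by rewrite (lt_le_trans (hN0 N _))// /h nnsfun_approxE le_approx.
  by apply: cvg_near_cst; exists N => // n /= /hN0 /gt0_muley.
have -> : \int[nu]_(x in D) f x = limn (fun n => \int[nu]_(x in D) (h n x)%:E).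
  rewrite -monotone_convergence//.
  - by apply: eq_integral => x /[!inE] Dx; apply/esym/cvg_lim => //; exact: h_cvg.
  - by move=> n; apply/measurable_EFinP/measurable_funTS.
  - by move=> n x _; rewrite lee_fin.
  - by move=> x _ m n mn; rewrite lee_fin h_nd.
have -> : \int[mu]_(x in D) (f x * g x) =
    limn (fun n => \int[mu]_(x in D) ((h n x)%:E * g x)).
  rewrite -monotone_convergence//.
  - by apply: eq_integral => x /[!inE] Dx; apply/esym/cvg_lim => //; exact: hg_cvg.
  - move=> n; apply: emeasurable_funM => //.
    exact/measurable_EFinP/measurable_funTS.
  - by move=> n x Dx; rewrite mule_ge0 ?lee_fin ?g0.
  - by move=> x Dx m n mn; rewrite lee_wpmul2r ?g0// lee_fin h_nd.
(* Both sides are now limits along the same sequence, so it is enough to compare the integrals of a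
   single simple function [h n], split over its level sets. *)
congr (limn _); apply/funext => n.
have mindic r : measurable_fun D (fun x => (r * \1_(h n @^-1` [set r]) x)%:E).
  by apply/measurable_EFinP/measurable_funTS; exact: measurable_funM.
transitivity (\int[nu]_(x in D)
    (\sum_(r \in range (h n)) (r * \1_(h n @^-1` [set r]) x)%:E)).
  by apply: eq_integral => x _; rewrite fimfunE -fsumEFin.
rewrite ge0_integral_fsum//; last by move=> r x _; exact: nnfun_muleindic_ge0.
transitivity (\int[mu]_(x in D)
    (\sum_(r \in range (h n)) (r * \1_(h n @^-1` [set r]) x)%:E * g x)).
  rewrite ge0_integral_fsum//; last 2 first.
  - by move=> r; exact: emeasurable_funM.
  - by move=> r x Dx; rewrite mule_ge0 ?g0 ?nnfun_muleindic_ge0.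
  (* Being a value of [h n], the level is nonnegative, so it can be taken out of the integral
     against [mu]. *)
  apply: eq_fsbigr => r /[!inE] -[t _ <-]; set s := h n t.
  rewrite integralZl_indic_nnsfun//.
  under [RHS]eq_integral do rewrite EFinM -muleA.
  rewrite ge0_integralZl//; last 3 first.
  - by apply: emeasurable_funM => //; exact/measurable_EFinP.
  - by move=> x Dx; rewrite mule_ge0 ?lee_fin ?g0.
  - by rewrite lee_fin.
  congr (_ * _); rewrite integral_indic// setIC nuE//.
  rewrite integral_mkcondr; apply: eq_integral => x _.
  by rewrite epatch_indic muleC.
(* The level sets are reassembled; as [g x] may be infinite, distributing it over the sum relies on
   the terms being nonnegative. *)
apply: eq_integral => x /[!inE] Dx.
rewrite -ge0_mule_fsuml => [|r]; last exact: nnfun_muleindic_ge0.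
by rewrite fsumEFin// -(fimfunE _ x).
Qed.

Section SpectralDensityTheory.
Context {R : realType}.
Implicit Types (f : R -> R) (u : R -> \bar R).

Lemma measurable_circle : measurable (circle : set (measurableTypeR R)).
Proof. exact: measurable_itv. Qed.

Lemma meanZl (k : \bar R) u : 0 <= k ->
  measurable_fun circle u -> (forall t, circle t -> 0 <= u t) ->
  mean lebesgue_measure (fun t => k * u t) = k * mean lebesgue_measure u.
Proof.
move=> k0 mu u0; rewrite /mean ge0_integralZl//; last exact: measurable_circle.
by rewrite muleCA.
Qed.

Lemma spectral_density_measurable f : spectral_density f ->
  measurable_fun circle (EFin \o f).
Proof. by move=> [_ /measurable_int]. Qed.

Lemma spectral_density_inve_ge0 f : spectral_density f ->
  forall t, circle t -> 0 <= (f t)%:E^-1.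
Proof. by move=> [f0 _] t /f0 ft0; rewrite inve_ge0 lee_fin. Qed.

Lemma integrable_inverse_measurable f : integrable_inverse f ->
  measurable_fun circle (fun t => (f t)%:E^-1).
Proof. by move=> /measurable_int. Qed.

(** An integrable function is finite almost everywhere, and the extended inverse is [+oo] at
    zero. *)
Lemma integrable_inverse_neq0 f : integrable_inverse f ->
  \forall t \ae lebesgue_measure, circle t -> f t != 0%R.
Proof.
move=> hi; apply: filterS (integrable_ae measurable_circle hi) => t /[apply].
by apply: contraTneq => ->; rewrite inve0.
Qed.

(** Finiteness is integrability. For positivity, a zero integral would make [f^-1] vanish almost
    everywhere; the extended inverse of a real number is never zero, so [circle], of length
    [2 * pi], would be a null set. *)
Lemma inverse_meanP f : spectral_density f -> integrable_inverse f ->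
  exists2 m : R, (0 < m)%R & inverse_mean f = m%:E.
Proof.
move=> hf hi; rewrite /inverse_mean /mean.
have fin := integrable_fin_num measurable_circle hi.
have pos : 0 < \int[lebesgue_measure]_(t in circle) (f t)%:E^-1.
  rewrite lt0e integral_ge0 ?andbT; last exact: spectral_density_inve_ge0.
  apply/eqP => int0.
  have : \int[lebesgue_measure]_(t in circle) `|(f t)%:E^-1| = 0.
    rewrite -int0; apply: eq_integral => t /[!inE] ct.
    by rewrite gee0_abs// spectral_density_inve_ge0.
  move=> /(ae_eq_integral_abs _ measurable_circle
    (integrable_inverse_measurable hi)).1 [N [mN N0 cN]].
  have : lebesgue_measure (circle : set R) <= lebesgue_measure N.
    apply: le_measure; rewrite ?inE//; first exact: measurable_circle.
    move=> t ct; apply: cN => /= /(_ ct) /eqP.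
    by rewrite inve_eq0.
  rewrite N0 lebesgue_measure_itv/= lte_fin.
  have pi0 := pi_gt0 R; rewrite ifT; last by rewrite gtrN.
  by rewrite -EFinB lee_fin leNgt opprK addr_gt0.
exists ((2 * pi)^-1 * fine (\int[lebesgue_measure]_(t in circle) (f t)%:E^-1))%R.
  by rewrite mulr_gt0 ?invr_gt0 ?mulr_gt0 ?pi_gt0// fine_gt0// pos ltey_eq fin.
by rewrite EFinM fineK.
Qed.

Lemma mean_phi f u : spectral_density f -> integrable_inverse f ->
  measurable_fun circle u -> (forall t, circle t -> 0 <= u t) ->
  mean (phi f) u =
  mean lebesgue_measure (fun t => u t * ((f t)%:E^-1 / inverse_mean f)).
Proof.
move=> hf hi mu u0; have [m m0 mE] := inverse_meanP hf hi.
pose g t := (f t)%:E^-1 / inverse_mean f.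
have g0 t : circle t -> 0 <= g t.
  move=> ct; rewrite mule_ge0 ?spectral_density_inve_ge0//.
  by rewrite mE inve_ge0 lee_fin ltW.
have mg : measurable_fun circle g.
  by apply: emeasurable_funM => //; exact: integrable_inverse_measurable.
have phi0 : phi f set0 = 0 by rewrite /phi set0I integral_set0.
have phi_ge0 A : 0 <= phi f A by apply: integral_ge0 => t [_ /g0].
have phi_sigma : semi_sigma_additive (phi f).
  (* Extending the density by zero outside [circle] presents [phi f] as the measure induced by a
     nonnegative function on the whole line. *)
  have -> : phi f = fun A => \int[lebesgue_measure]_(t in A) (g \_ circle) t.
    by apply/funext => A; rewrite /phi integral_mkcondr.
  apply: semi_sigma_additive_nng_induced.
    by apply/(measurable_restrictT _ measurable_circle).
  by move=> t; apply: erestrict_ge0.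
pose nu : {measure set (measurableTypeR R) -> \bar R} :=
  HB.pack (phi f) (isMeasure.Build _ _ _ (phi f) phi0 phi_ge0 phi_sigma).
rewrite /mean; congr (_ * _).
apply: (@ge0_integral_density _ _ _ lebesgue_measure nu) => //.
  exact: measurable_circle.
by move=> A mA Ac; rewrite /= /phi (setIidl Ac).
Qed.

(* The weight [f^-1] of [phi f] cancels the factor [f], except on the null set
   where [f] vanishes: there [0 * +oo = 0]. *)
Lemma mean_phiM f u : spectral_density f -> integrable_inverse f ->
  measurable_fun circle u -> (forall t, circle t -> 0 <= u t) ->
  mean (phi f) (fun t => (f t)%:E * u t) =
  mean lebesgue_measure u / inverse_mean f.
Proof.
move=> hf hi mu u0; have [m m0 mE] := inverse_meanP hf hi.
have f0 t : circle t -> 0 <= (f t)%:E by move=> /hf.1; rewrite lee_fin.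
have mf := spectral_density_measurable hf.
have inv0 : 0 <= (inverse_mean f)^-1 by rewrite mE inve_ge0 lee_fin ltW.
rewrite mean_phi//; last 2 first.
- exact: emeasurable_funM.
- by move=> t ct; rewrite mule_ge0 ?f0 ?u0.
rewrite muleC -meanZl// /mean; congr (_ * _); apply: ge0_ae_eq_integral.
- exact: measurable_circle.
- apply: emeasurable_funM; first exact: emeasurable_funM.
  by apply: emeasurable_funM => //; exact: integrable_inverse_measurable.
- exact: emeasurable_funM.
- by move=> t ct; rewrite !mule_ge0 ?f0 ?u0 ?spectral_density_inve_ge0.
- by move=> t ct; rewrite mule_ge0 ?u0.
- have [N [mN N0 fN]] := integrable_inverse_neq0 hi.
  exists N; split=> // t /= fuN; apply: fN => /= fN; apply: fuN => /fN ft0.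
  by rewrite muleACA [_ * (f t)%:E^-1]muleC mulVe// mul1e muleC.
Qed.

End SpectralDensityTheory.

(** At [r = 0] both sides are [+oo], so this can be used pointwise even where a density vanishes. *)
Lemma inve_sqr (R : realType) (r : R) : (r%:E ^+ 2)^-1 = r%:E^-1 ^+ 2.
Proof.
have [->|r0] := eqVneq r 0%R; first by rewrite expe2 mule0 inve0 expe2 mulyy.
by rewrite -EFin_expe !inver expf_eq0 (negPf r0) -EFin_expe exprVn.
Qed.

Theorem mainTheorem8 (R : realType) (f1 f2 : R -> R)
    (hf1 : spectral_density f1) (hf2 : spectral_density f2)
    (hi1 : integrable_inverse f1) (hi2 : integrable_inverse f2) :
  rho_smooth f1 f2 =
    mean lebesgue_measure (fun t => (f1 t)%:E / (f2 t)%:E ^+ 2) *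
    (mean lebesgue_measure (fun t => (f1 t)%:E^-1) /
     mean lebesgue_measure (fun t => (f2 t)%:E^-1) ^+ 2)
  /\
  mean lebesgue_measure (fun t => (f1 t)%:E / (f2 t)%:E ^+ 2) *
    (mean lebesgue_measure (fun t => (f1 t)%:E^-1) /
     mean lebesgue_measure (fun t => (f2 t)%:E^-1) ^+ 2) =
  (sqrte (mean (phi f1) (fun t => ((f1 t)%:E / (f2 t)%:E) ^+ 2)) /
   mean (phi f1) (fun t => (f1 t)%:E / (f2 t)%:E)) ^+ 2.
Proof.
have [a a0 aE] := inverse_meanP hf1 hi1.
have [b b0 bE] := inverse_meanP hf2 hi2.
have mf1 := spectral_density_measurable hf1.
have mi2 := integrable_inverse_measurable hi2.
have f1_ge0 t : circle t -> 0 <= (f1 t)%:E by move=> /hf1.1; rewrite lee_fin.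
have i2_ge0 := spectral_density_inve_ge0 hf2.
have QE t : (f1 t)%:E / (f2 t)%:E ^+ 2 =
    (f1 t)%:E / (f2 t)%:E * (f2 t)%:E^-1.
  by rewrite inve_sqr expe2 muleA.
have mQ : measurable_fun circle (fun t => (f1 t)%:E / (f2 t)%:E ^+ 2).
  under eq_fun do rewrite QE.
  by do 2 apply: emeasurable_funM => //.
have Q_ge0 t : circle t -> 0 <= (f1 t)%:E / (f2 t)%:E ^+ 2.
  by move=> ct; rewrite QE !mule_ge0 ?f1_ge0 ?i2_ge0.
set M := mean lebesgue_measure (fun t => (f1 t)%:E / (f2 t)%:E ^+ 2).
have M_ge0 : 0 <= M.
  rewrite mule_ge0 ?lee_fin ?invr_ge0 ?mulr_ge0 ?pi_ge0//.
  exact: integral_ge0.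
rewrite -/(inverse_mean f1) -/(inverse_mean f2) aE bE.
have inva : (a%:E)^-1 = (a^-1)%:E by rewrite inver gt_eqF.
have invb : (b%:E)^-1 = (b^-1)%:E by rewrite inver gt_eqF.
split.
  rewrite /rho_smooth /Defs.harmonic_mean aE inveK.
  (* The squared constant [h_f2 ^+ 2] leaves the integral; [M] may be [+oo] and is kept as one
     factor throughout. *)
  have -> : smoothing_variance f2 f1 = (b%:E ^+ 2)^-1 * M.
    rewrite -meanZl//; last by rewrite inve_ge0 sqre_ge0.
    rewrite /smoothing_variance /mean; congr (_ * _).
    apply: eq_integral => t /[!inE] ct.
    rewrite /smoothing_error /Defs.harmonic_mean bE.
    rewrite gee0_abs; last by rewrite mule_ge0 ?i2_ge0// inve_ge0 lee_fin ltW.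
    by rewrite !inve_sqr !expe2 muleACA [(f1 t)%:E * _]muleC !muleA.
  by rewrite -muleA muleCA; congr (_ * _); rewrite muleC.
(* One factor [f1] is split off so that [mean_phiM] applies to both means, with [u] equal to
   [f1 / f2 ^+ 2] and to [f2^-1]. *)
rewrite (_ : (fun t => ((f1 t)%:E / (f2 t)%:E) ^+ 2) =
    (fun t => (f1 t)%:E * ((f1 t)%:E / (f2 t)%:E ^+ 2))); last first.
  by apply/funext => t; rewrite inve_sqr !expe2 muleACA -muleA.
rewrite !mean_phiM// -/M -/(inverse_mean f2) aE bE inva.
have -> : (b%:E * (a^-1)%:E)^-1 = (a / b)%:E.
  by rewrite -EFinM inver gt_eqF ?divr_gt0// invf_div.
rewrite [RHS]expe2 [RHS]muleACA -!expe2 sqr_sqrte; last first.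
  by rewrite mule_ge0// lee_fin invr_ge0 ltW.
(* Once [M] is cancelled, the rest is an identity between reals:
   [a / b ^+ 2 = a^-1 * (a / b) ^+ 2]. *)
rewrite -[RHS]muleA; congr (M * _).
rewrite inve_sqr invb -!EFin_expe -!EFinM; congr EFin.
by field; rewrite !gt_eqF.
Qed.
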